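(* There exists a frequently hypercyclic bounded linear operator $T$ on the Banach space $c_0(\mathbb Z)$ which does not admit any ergodic Borel probability measure with full support.
   Context: $T$ is frequently hypercyclic if there is $x$ such that for every nonempty open $V$, $\liminf_{N\to\infty}\frac1N\#\{n\in[1,N]:T^nx\in V\}>0$. A $T$-invariant Borel probability measure $m$ is ergodic if every Borel set $A$ with $T^{-1}(A)=A$ satisfies $m(A)\in\{0,1\}$; it has full support if $m(U)>0$ for every nonempty open $U$. *)

(* Defs.v *)
From Stdlib Require Import Reals ZArith Classical ClassicalEpsilon.
Open Scope R_scope.

Definition vanishes_at_infinity (x : Z -> R) : Prop :=
  forall eps, 0 < eps -> exists N : Z,
    forall n : Z, (N < Z.abs n)%Z -> Rabs (x n) < eps.

Definition c0Z : Type := { x : Z -> R | vanishes_at_infinity x }.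

Definition cval (x : c0Z) : Z -> R := proj1_sig x.

(** ||x - y||_oo < eps  (the sup is attained-or-approached; we state it as
    "bounded by some r < eps", which is exactly sup < eps). *)
Definition dist_lt (x y : c0Z) (eps : R) : Prop :=
  exists r, r < eps /\ forall n, Rabs (cval x n - cval y n) <= r.

Definition is_open (U : c0Z -> Prop) : Prop :=
  forall x, U x -> exists eps, 0 < eps /\ forall y, dist_lt x y eps -> U y.

Definition is_linear (T : c0Z -> c0Z) : Prop :=
  forall (a b : R) (x y z : c0Z),
    (forall n, cval z n = a * cval x n + b * cval y n) ->
    forall n, cval (T z) n = a * cval (T x) n + b * cval (T y) n.

Definition is_bounded (T : c0Z -> c0Z) : Prop :=
  exists C, 0 <= C /\ forall (x : c0Z) (r : R),
    (forall n, Rabs (cval x n) <= r) -> forall n, Rabs (cval (T x) n) <= C * r.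

Definition bounded_linear_operator (T : c0Z -> c0Z) : Prop :=
  is_linear T /\ is_bounded T.

Fixpoint iter {X : Type} (n : nat) (T : X -> X) (x : X) : X :=
  match n with O => x | S k => T (iter k T x) end.

Fixpoint count_upto (P : nat -> Prop) (N : nat) : nat :=
  match N with
  | O => O
  | S k => (if excluded_middle_informative (P (S k)) then 1 else 0)%nat
           + count_upto P k
  end.

Definition positive_lower_density (P : nat -> Prop) : Prop :=
  exists delta, 0 < delta /\ exists N0 : nat, forall N : nat, (N0 <= N)%nat ->
    delta <= INR (count_upto P N) / INR N.

Definition frequently_hypercyclic (T : c0Z -> c0Z) : Prop :=
  exists x : c0Z, forall V : c0Z -> Prop, is_open V -> (exists v, V v) ->
    positive_lower_density (fun n => V (iter n T x)).

Inductive borel : (c0Z -> Prop) -> Prop :=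
  | borel_open : forall U, is_open U -> borel U
  | borel_compl : forall A, borel A -> borel (fun x => ~ A x)
  | borel_union : forall A : nat -> c0Z -> Prop, (forall n, borel (A n)) ->
      borel (fun x => exists n, A n x).

(** Borel probability measures (set functions whose values off Borel sets
    are irrelevant). *)
Definition borel_probability (m : (c0Z -> Prop) -> R) : Prop :=
  (forall A, borel A -> 0 <= m A) /\
  m (fun _ => True) = 1 /\
  (forall A : nat -> c0Z -> Prop,
     (forall n, borel (A n)) ->
     (forall i j x, i <> j -> A i x -> A j x -> False) ->
     infinite_sum (fun n => m (A n)) (m (fun x => exists n, A n x))).

Definition invariant_measure (T : c0Z -> c0Z) (m : (c0Z -> Prop) -> R) : Prop :=
  forall A, borel A -> m (fun x => A (T x)) = m A.

Definition ergodic (T : c0Z -> c0Z) (m : (c0Z -> Prop) -> R) : Prop :=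
  forall A, borel A -> (forall x, A (T x) <-> A x) -> m A = 0 \/ m A = 1.

Definition full_support (m : (c0Z -> Prop) -> R) : Prop :=
  forall U, is_open U -> (exists u, U u) -> 0 < m U.

(* Main.v *)
From Stdlib Require Import Reals ZArith Classical ClassicalEpsilon.
From Stdlib Require Import Lra Lia Arith Cantor FunctionalExtensionality PropExtensionality.
Require Import Defs.
Open Scope R_scope.

(** The operator is a weighted backward shift, conjugate to the plain shift on sequences
    [a] with norm [sup_j weight j * |a j|].  Every [p] receives a set of visit times of
    positive lower density: multiples of [16 ^ (p + 1)] in the windows
    [(16 ^ u, 2 * 16 ^ u]] whose index [u] has 2-adic valuation [p].  The weight decays
    geometrically on the positive side; on the negative side it is tiny close to [- d]
    whenever [d] is a difference of visit times, so placing a copy of the [p]-th vector of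
    a dense sequence at each visit time of [p] yields a frequently hypercyclic vector.

    Away from these differences the weight on the negative side is [1], which happens for
    a set of [d] of density at least 1/2 in arbitrarily long intervals.  Hence as soon as
    an orbit meets [|x_0| > r], it is outside the ball of radius [r] for a proportion of
    time bounded below independently of [r].  An ergodic measure with full support would
    therefore give mass at least 1/4 to the complement of every ball. *)

(** * Visit times and their differences *)

Section Combinatorics.
Local Open Scope nat_scope.

Lemma pow16_pos r : 1 <= 16 ^ r.
Proof. assert (16 ^ r <> 0) by (apply Nat.pow_nonzero; lia); lia. Qed.

Lemma pow16_ge r : 1 <= r -> 16 * r <= 16 ^ r.
Proof.
  induction r as [|r IH]; intros H; [lia|].
  rewrite Nat.pow_succ_r'. destruct r as [|r]; [simpl; lia|].
  specialize (IH ltac:(lia)). lia.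
Qed.

Lemma pow16_lt u v : u < v -> 16 * 16 ^ u <= 16 ^ v.
Proof.
  intros H. rewrite <- Nat.pow_succ_r'. apply Nat.pow_le_mono_r; lia.
Qed.

(** Differences of visit times take two forms: within one window they are multiples of [16 ^ r], and
    across windows they agree with [16 ^ r] up to a factor 2. *)
Definition anchor (r e : nat) : bool :=
  (0 <? e) && ((e mod 16 ^ r =? 0) || ((16 ^ r <=? 2 * e) && (e <=? 2 * 16 ^ r))).

Lemma anchorP r e :
  anchor r e = true <->
  0 < e /\ (Nat.divide (16 ^ r) e \/ (16 ^ r <= 2 * e /\ e <= 2 * 16 ^ r)).
Proof.
  unfold anchor. pose proof (pow16_pos r).
  rewrite Bool.andb_true_iff, Bool.orb_true_iff, Bool.andb_true_iff.
  rewrite Nat.ltb_lt, Nat.eqb_eq, !Nat.leb_le.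
  rewrite Nat.Lcm0.mod_divide. tauto.
Qed.

Lemma anchor_large r e : anchor r e = true -> 16 ^ r <= 2 * e.
Proof.
  rewrite anchorP; intros [He [[k ->]|H]]; [|lia].
  destruct k; [lia|]. nia.
Qed.

(** An anchor [e] of order [r] acts from [e - r] on with height [4 * r]: after the loss of one unit
    per step, [2 * r] is still left at [e + r]. *)
Fixpoint jump_upto (d r : nat) : nat :=
  match r with
  | 0 => 0
  | S q => Nat.max (if anchor (S q) (d + S q) then 4 * S q else 0) (jump_upto d q)
  end.

Definition jump (d : nat) : nat := jump_upto d d.

(* Wherever [t] is within [r] of an anchor, [depth t >= 2 * r]; one unit of
   depth is lost per step, so that the shift defined below is bounded. *)
Fixpoint depth (d : nat) : nat :=
  match d with
  | 0 => 0
  | S k => Nat.max (depth k - 1) (jump (S k))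
  end.

Lemma jump_upto_ge d r q :
  1 <= r <= q -> anchor r (d + r) = true -> 4 * r <= jump_upto d q.
Proof.
  induction q as [|q IH]; intros Hr Ha; [lia|].
  cbn [jump_upto]. destruct (Nat.eq_dec r (S q)) as [->|Hn].
  - rewrite Ha. lia.
  - specialize (IH ltac:(lia) Ha). lia.
Qed.

Lemma jump_upto_pos d q :
  0 < jump_upto d q ->
  exists r, 1 <= r /\ anchor r (d + r) = true /\ jump_upto d q = 4 * r.
Proof.
  induction q as [|q IH]; cbn [jump_upto]; [lia|].
  intros H. destruct (anchor (S q) (d + S q)) eqn:Ha.
  - destruct (Nat.le_gt_cases (jump_upto d q) (4 * S q)).
    + exists (S q). repeat split; [lia|exact Ha|lia].
    + destruct IH as [r (H1 & H2 & H3)]; [lia|].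
      exists r; repeat split; auto; lia.
  - destruct IH as [r (H1 & H2 & H3)]; [lia|].
    exists r; repeat split; auto; lia.
Qed.

Lemma depth_ge d e : 1 <= e <= d -> jump e <= depth d + (d - e).
Proof.
  induction d as [|d IH]; intros He; [lia|].
  cbn [depth]. destruct (Nat.eq_dec e (S d)) as [->|Hn]; [lia|].
  specialize (IH ltac:(lia)). lia.
Qed.

Lemma depth_pos d : 0 < depth d -> exists e, e <= d /\ depth d + (d - e) <= jump e.
Proof.
  induction d as [|d IH]; cbn [depth]; [lia|]. intros H.
  destruct (Nat.le_gt_cases (depth d - 1) (jump (S d))).
  - exists (S d). split; lia.
  - destruct IH as [e [H1 H2]]; [lia|]. exists e. split; lia.
Qed.

Lemma depth_succ d : depth d <= S (depth (S d)).
Proof. cbn [depth]. lia. Qed.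

Lemma anchor_depth r e t :
  1 <= r -> anchor r e = true -> e <= t + r -> t <= e + r -> 2 * r <= depth t.
Proof.
  intros Hr Ha H1 H2. pose proof (pow16_ge r Hr). pose proof (anchor_large r e Ha).
  assert (Hj : 4 * r <= jump (e - r)).
  { apply jump_upto_ge; [lia|]. replace (e - r + r) with e by lia. exact Ha. }
  pose proof (depth_ge t (e - r) ltac:(lia)). lia.
Qed.

(** * Density of the zeros of [depth] *)

Fixpoint count (P : nat -> bool) (a n : nat) : nat :=
  match n with
  | 0 => 0
  | S k => count P a k + (if P (a + k) then 1 else 0)
  end.

Lemma count_add P a n k : count P a (n + k) = count P a n + count P (a + n) k.
Proof.
  induction k as [|k IH]; [rewrite Nat.add_0_r; simpl; lia|].
  rewrite Nat.add_succ_r. cbn [count]. rewrite IH, Nat.add_assoc. lia.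
Qed.

Lemma count_mul P n h k :
  (forall a, count P a n <= h) -> forall a, count P a (k * n) <= k * h.
Proof.
  intros H. induction k as [|k IH]; intros a; [simpl; lia|].
  cbn [Nat.mul]. rewrite count_add. specialize (H a). specialize (IH (a + n)). lia.
Qed.

Lemma count_orb P Q a n : count (fun d => P d || Q d)%bool a n <= count P a n + count Q a n.
Proof.
  induction n as [|n IH]; cbn [count]; [lia|].
  destruct (P (a + n)), (Q (a + n)); cbn [orb]; lia.
Qed.

(** By periodicity the count over a full period does not depend on its start; from [b * c - c] on,
    the residues are [0, ..., b - 1] in order. *)
Lemma count_mod_lt b c t a : 1 <= b -> count (fun d => (d + c) mod b <? t) a b <= t.
Proof.
  intros Hb. set (P := fun d => (d + c) mod b <? t).
  assert (Hshift : forall a, count P (S a) b = count P a b).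
  { intros a'. pose proof (count_add P a' 1 b) as H1. pose proof (count_add P a' b 1) as H2.
    rewrite Nat.add_comm in H1. rewrite H1 in H2. cbn [count] in H2.
    rewrite !Nat.add_0_r, Nat.add_1_r in H2.
    replace (P (a' + b)) with (P a') in H2; [lia|].
    unfold P. f_equal. replace (a' + b + c) with (a' + c + 1 * b) by lia.
    now rewrite Nat.Div0.mod_add. }
  assert (Hconst : forall a, count P a b = count P 0 b).
  { intros a'; induction a' as [|a' IH]; [auto|]. now rewrite Hshift. }
  assert (Hmul : count P a b = count P (b * c - c) b) by now rewrite !Hconst.
  rewrite Hmul.
  assert (H : forall n, n <= b -> count P (b * c - c) n <= Nat.min n t).
  { induction n as [|n IH]; intros Hn; cbn [count]; [lia|].
    specialize (IH ltac:(lia)).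
    replace (P (b * c - c + n)) with (n <? t).
    - destruct (Nat.ltb_spec n t); lia.
    - unfold P. f_equal. replace (b * c - c + n + c) with (n + c * b) by nia.
      rewrite Nat.Div0.mod_add. symmetry. apply Nat.mod_small; lia. }
  specialize (H b ltac:(lia)). lia.
Qed.

(** With [r = S v], the test places [d] in [[e - r, e + 3 * r)] for a multiple [e] of [16 ^ r]:
    exactly where a jump of [4 * r] at [e - r] has not yet decayed. *)
Fixpoint near_multiple (w d : nat) : bool :=
  match w with
  | 0 => false
  | S v => near_multiple v d || ((d + S v) mod 16 ^ S v <? 4 * S v)
  end.

Lemma near_multipleI w r e d :
  1 <= r <= w -> Nat.divide (16 ^ r) e -> e <= d + r -> d < e + 3 * r ->
  near_multiple w d = true.
Proof.
  intros Hr [k ->] H1 H2. induction w as [|w IH]; [lia|]. cbn [near_multiple].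
  destruct (Nat.eq_dec r (S w)) as [<-|Hn].
  - apply Bool.orb_true_iff. right. apply Nat.ltb_lt.
    pose proof (pow16_ge r ltac:(lia)).
    replace (d + r) with ((d + r - k * 16 ^ r) + k * 16 ^ r) by lia.
    rewrite Nat.Div0.mod_add, Nat.mod_small; lia.
  - rewrite IH by lia. reflexivity.
Qed.

(** The slack [w + 1] closes the induction: sixteen blocks turn it into [16 * (w + 1)], which pays
    for at most [4 * (w + 1)] new points and for the next slack [w + 2]. *)
Lemma count_near_multiple w a :
  1 <= w -> 2 * (count (near_multiple w) a (16 ^ w) + w + 1) <= 16 ^ w.
Proof.
  revert a. induction w as [|w IH]; intros a Hw; [lia|].
  cbn [near_multiple].
  pose proof (count_orb (near_multiple w)
    (fun d => (d + S w) mod 16 ^ S w <? 4 * S w) a (16 ^ S w)) as H1.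
  pose proof (count_mod_lt (16 ^ S w) (S w) (4 * S w) a (pow16_pos _)) as H2.
  rewrite Nat.pow_succ_r' in *.
  assert (H3 : 1 <= w -> 2 * (count (near_multiple w) a (16 * 16 ^ w)) + 32 * (w + 1) <= 16 * 16 ^ w).
  { intros Hw1.
    pose proof (count_mul (near_multiple w) (16 ^ w) (16 ^ w / 2 - w - 1) 16) as H3.
    assert (Hx : forall a, count (near_multiple w) a (16 ^ w) <= 16 ^ w / 2 - w - 1).
    { intros a'. specialize (IH a' Hw1).
      assert (count (near_multiple w) a' (16 ^ w) + w + 1 <= 16 ^ w / 2)
        by (apply Nat.div_le_lower_bound; lia). lia. }
    specialize (H3 Hx a). pose proof (Nat.Div0.mul_div_le (16 ^ w) 2).
    specialize (IH a Hw1).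
    assert (w + 1 <= 16 ^ w / 2) by (apply Nat.div_le_lower_bound; lia). lia. }
  destruct w as [|w].
  - assert (count (near_multiple 0) a (16 * 16 ^ 0) = 0).
    { clear. generalize (16 * 16 ^ 0). induction n as [|n IH]; [reflexivity|]. now cbn in *; rewrite IH. }
    change (16 ^ 0) with 1 in *. lia.
  - specialize (H3 ltac:(lia)). lia.
Qed.

(** The range of [d] isolates the multiples: anchors of order above [w] are at least [8 * 16 ^ w],
    and those given by the size condition at order at most [w] have lost their effect before
    [4 * 16 ^ w]. *)
Lemma depth_near_multiple w d :
  1 <= w -> 4 * 16 ^ w <= d < 6 * 16 ^ w -> 0 < depth d -> near_multiple w d = true.
Proof.
  intros Hw Hd Hpos. destruct (depth_pos d Hpos) as [e' [He1 He2]].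
  destruct (jump_upto_pos e' e') as [r (Hr1 & Hr2 & Hr3)]; [unfold jump in He2; lia|].
  fold (jump e') in Hr3. remember (e' + r) as e eqn:Ee.
  pose proof (pow16_ge r Hr1). pose proof (anchor_large r e Hr2).
  assert (Hrw : r <= w).
  { destruct (Nat.le_gt_cases r w) as [|Hlt]; [auto|].
    pose proof (pow16_lt w r Hlt). lia. }
  assert (16 ^ r <= 16 ^ w) by (apply Nat.pow_le_mono_r; lia).
  apply anchorP in Hr2. destruct Hr2 as [_ [Hdiv|Hwin]]; [|lia].
  apply (near_multipleI w r e); auto; lia.
Qed.

Lemma count_depth_zero w a :
  1 <= w -> 4 * 16 ^ w <= a <= 5 * 16 ^ w ->
  16 ^ w <= 2 * count (fun d => depth d =? 0) a (16 ^ w).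
Proof.
  intros Hw Ha. pose proof (count_near_multiple w a Hw) as H.
  assert (Hsum : forall n, n <= 16 ^ w ->
    n <= count (near_multiple w) a n + count (fun d => depth d =? 0) a n).
  { induction n as [|n IH]; intros Hn; cbn [count]; [lia|].
    specialize (IH ltac:(lia)). destruct (Nat.eqb_spec (depth (a + n)) 0); [lia|].
    rewrite (depth_near_multiple w) by lia. lia. }
  specialize (Hsum (16 ^ w) ltac:(lia)). lia.
Qed.

(** * Separation of visit times *)

Definition visit (p n : nat) : Prop :=
  exists u k, u = 2 ^ p * (2 * k + 1) /\ 16 ^ u < n <= 2 * 16 ^ u /\
    Nat.divide (16 ^ S p) n.

Lemma pow2_gt p : p < 2 ^ p.
Proof. apply Nat.pow_gt_lin_r; lia. Qed.

Lemma odd_part_unique p q k l : 2 ^ p * (2 * k + 1) = 2 ^ q * (2 * l + 1) -> p = q.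
Proof.
  assert (H : forall p q k l, p < q -> 2 ^ p * (2 * k + 1) <> 2 ^ q * (2 * l + 1)).
  { intros p' q' k' l' Hlt E. replace q' with (p' + S (q' - p' - 1)) in E by lia.
    rewrite Nat.pow_add_r, <- Nat.mul_assoc in E.
    apply Nat.mul_cancel_l in E; [|apply Nat.pow_nonzero; lia].
    rewrite Nat.pow_succ_r' in E. lia. }
  intros E. destruct (Nat.lt_total p q) as [Hlt|[Heq|Hlt]]; auto.
  - now apply H in E.
  - symmetry in E. now apply H in E.
Qed.

(** Within one window [p = q], and both times are multiples of [16 ^ S p]. For windows [u < v], the
    earlier time is at most an eighth of [16 ^ v], so the difference is comparable to [16 ^ v]. *)
Lemma visit_sep p q n m :
  visit p n -> visit q m -> n < m -> exists r, p < r /\ q < r /\ anchor r (m - n) = true.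
Proof.
  intros (u & k & Hu & Hn & Hdn) (v & l & Hv & Hm & Hdm) Hlt.
  pose proof (pow2_gt p). pose proof (pow2_gt q).
  assert (p < u) by nia. assert (q < v) by nia.
  destruct (Nat.lt_total u v) as [Huv|[Huv|Huv]].
  - exists v. repeat split; [lia|lia|]. apply anchorP.
    pose proof (pow16_lt u v Huv). split; [lia|]. right. lia.
  - assert (p = q) as <- by (apply (odd_part_unique p q k l); lia).
    exists (S p). repeat split; [lia|lia|]. apply anchorP. split; [lia|].
    left. now apply Nat.divide_sub_r.
  - pose proof (pow16_lt v u Huv). lia.
Qed.

Lemma visit_unique p q n : visit p n -> visit q n -> p = q.
Proof.
  intros (u & k & Hu & Hn & Hdn) (v & l & Hv & Hm & Hdm).
  apply (odd_part_unique p q k l). rewrite <- Hu, <- Hv.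
  destruct (Nat.lt_total u v) as [Huv|[Huv|Huv]]; auto.
  - pose proof (pow16_lt u v Huv). lia.
  - pose proof (pow16_lt v u Huv). lia.
Qed.

Lemma visit_large p n : visit p n -> 16 * p < n.
Proof.
  intros (u & k & Hu & Hn & Hdn). pose proof (pow2_gt p).
  assert (p < u) by nia. pose proof (pow16_ge u ltac:(lia)). lia.
Qed.

End Combinatorics.

(** * Lower density of the visit times *)

Lemma count_upto_le (P : nat -> Prop) n m : (n <= m)%nat -> (count_upto P n <= count_upto P m)%nat.
Proof. induction 1 as [|m _ IH]; cbn [count_upto]; lia. Qed.

Lemma count_upto_mono (P Q : nat -> Prop) n :
  (forall i, P i -> Q i) -> (count_upto P n <= count_upto Q n)%nat.
Proof.
  intros H. induction n as [|n IH]; cbn [count_upto]; [lia|].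
  destruct (excluded_middle_informative (P (S n))) as [p|p];
  destruct (excluded_middle_informative (Q (S n))) as [q|q]; try lia.
  elim q; auto.
Qed.

Lemma count_upto_progression (P : nat -> Prop) a b k :
  (1 <= b)%nat -> (forall i, (1 <= i <= k)%nat -> P ((a + i) * b)%nat) ->
  (k <= count_upto P ((a + k) * b))%nat.
Proof.
  intros Hb. induction k as [|k IH]; intros H; [lia|].
  specialize (IH ltac:(intros; apply H; lia)). specialize (H (S k) ltac:(lia)).
  remember ((a + S k) * b)%nat as n eqn:En. destruct n as [|n]; [nia|].
  cbn [count_upto]. destruct (excluded_middle_informative (P (S n))); [|tauto].
  pose proof (count_upto_le P ((a + k) * b) n ltac:(nia)). lia.
Qed.

Lemma positive_lower_density_mono (P Q : nat -> Prop) :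
  (forall i, P i -> Q i) -> positive_lower_density P -> positive_lower_density Q.
Proof.
  (* [S N0] keeps [N] positive, so that dividing by it preserves the order. *)
  intros H [d [Hd [N0 HN]]]. exists d. split; [exact Hd|]. exists (S N0).
  intros N HNN. eapply Rle_trans; [apply (HN N); lia|].
  apply Rmult_le_compat_r.
  - apply Rlt_le, Rinv_0_lt_compat, lt_0_INR. lia.
  - apply le_INR. now apply count_upto_mono.
Qed.

Lemma visit_density p : positive_lower_density (visit p).
Proof.
  (* Indices of valuation [p] are [2 * 2 ^ p] apart, so some window [u] lies below [N] with
     [N < 16 ^ (u + 2 * 2 ^ p + 1)]. It holds [16 ^ (u - S p)] visits, and [c] bounds the difference
     of the exponents. *)
  set (c := (2 * 2 ^ p + p + 3)%nat).
  exists (/ INR (16 ^ c)). split.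
  { apply Rinv_0_lt_compat, lt_0_INR. pose proof (pow16_pos c). lia. }
  (* Beyond this threshold the first window of [p], of index [2 ^ p], is complete. *)
  exists (16 ^ (2 ^ p + 1))%nat. intros N HN.
  pose proof (pow16_pos (2 ^ p + 1)).
  (* [v] is the integer part of log_16 N *)
  set (v := (Nat.log2 N / 4)%nat).
  assert (Hv : (16 ^ v <= N < 16 ^ S v)%nat).
  { change 16%nat with (2 ^ 4)%nat. rewrite <- !Nat.pow_mul_r.
    pose proof (Nat.log2_spec N ltac:(lia)) as [H1 H2].
    pose proof (Nat.div_mod_eq (Nat.log2 N) 4). fold v in H0.
    pose proof (Nat.mod_upper_bound (Nat.log2 N) 4 ltac:(lia)).
    split.
    - eapply Nat.le_trans; [|exact H1]. apply Nat.pow_le_mono_r; lia.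
    - eapply Nat.lt_le_trans; [exact H2|]. apply Nat.pow_le_mono_r; lia. }
  assert (Hv2 : (2 ^ p + 1 <= v)%nat).
  { destruct (Nat.le_gt_cases (2 ^ p + 1) v) as [|Hlt]; auto.
    assert (16 ^ S v <= 16 ^ (2 ^ p + 1))%nat by (apply Nat.pow_le_mono_r; lia). lia. }
  assert (Hk : exists k, (2 ^ p * (2 * k + 1) + 1 <= v < 2 ^ p * (2 * k + 1) + 1 + 2 * 2 ^ p)%nat).
  { exists ((v - 1 - 2 ^ p) / (2 * 2 ^ p))%nat.
    pose proof (Nat.div_mod_eq (v - 1 - 2 ^ p) (2 * 2 ^ p)).
    pose proof (pow2_gt p).
    pose proof (Nat.mod_upper_bound (v - 1 - 2 ^ p) (2 * 2 ^ p) ltac:(lia)).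
    set (k := ((v - 1 - 2 ^ p) / (2 * 2 ^ p))%nat) in *.
    replace (2 ^ p * (2 * k + 1))%nat with (2 * 2 ^ p * k + 2 ^ p)%nat by ring. lia. }
  destruct Hk as [k Hk]. set (u := (2 ^ p * (2 * k + 1))%nat) in *.
  pose proof (pow2_gt p). assert (Hpu : (S p <= u)%nat) by (unfold u; nia).
  assert (Hsplit : (16 ^ u = 16 ^ (u - S p) * 16 ^ S p)%nat).
  { rewrite <- Nat.pow_add_r. f_equal. lia. }
  pose proof (pow16_pos (S p)) as Hb.
  assert (Hcount : (16 ^ (u - S p) <= count_upto (visit p) N)%nat).
  { eapply Nat.le_trans; [apply (count_upto_progression (visit p) (16 ^ (u - S p)) (16 ^ S p))|].
    - apply pow16_pos.
    - intros i Hi. exists u, k. split; [reflexivity|].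
      split; [rewrite Hsplit; nia|]. now exists (16 ^ (u - S p) + i)%nat.
    - apply count_upto_le. pose proof (pow16_lt u v ltac:(lia)). nia. }
  apply le_INR in Hcount.
  assert (HNle : INR N <= INR (16 ^ (u - S p)) * INR (16 ^ c)).
  { rewrite <- mult_INR, <- Nat.pow_add_r. apply le_INR.
    eapply Nat.le_trans; [apply Nat.lt_le_incl; apply Hv|]. apply Nat.pow_le_mono_r; unfold c; lia. }
  assert (0 < INR N) by (apply lt_0_INR; lia).
  assert (0 < INR (16 ^ c)) by (apply lt_0_INR; pose proof (pow16_pos c); lia).
  apply (Rmult_le_reg_r (INR N)); [lra|].
  unfold Rdiv. rewrite Rmult_assoc, Rinv_l by lra.
  apply (Rmult_le_reg_l (INR (16 ^ c))); [lra|].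
  rewrite <- Rmult_assoc, Rinv_r by lra. nra.
Qed.

(** * Borel probability measures *)

Lemma pred_ext {X : Type} (A B : X -> Prop) : (forall x, A x <-> B x) -> A = B.
Proof.
  intros H. apply functional_extensionality. intros x.
  apply propositional_extensionality. apply H.
Qed.

Lemma borel_ext (A B : c0Z -> Prop) : (forall x, A x <-> B x) -> borel A -> borel B.
Proof. intros H. now rewrite (pred_ext A B H). Qed.

Lemma borel_all (A : nat -> c0Z -> Prop) :
  (forall n, borel (A n)) -> borel (fun x => forall n, A n x).
Proof.
  intros H. apply (borel_ext (fun x => ~ exists n, ~ A n x)).
  - intros x. split.
    + intros Hn n. apply NNPP. intros Hc. apply Hn. now exists n.
    + intros Ha [n Hn]. auto.
  - apply borel_compl, (borel_union (fun n x => ~ A n x)). intros n. now apply borel_compl.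
Qed.

Lemma borel_and (A B : c0Z -> Prop) : borel A -> borel B -> borel (fun x => A x /\ B x).
Proof.
  intros HA HB.
  apply (borel_ext (fun x => forall n : nat, (match n with O => A | S _ => B end) x)).
  - intros x. split.
    + intros H. split; [apply (H 0%nat)|apply (H 1%nat)].
    + intros [Ha Hb] [|n]; auto.
  - apply (borel_all (fun n => match n with O => A | S _ => B end)). intros [|n]; auto.
Qed.

Lemma borel_const (P : Prop) : borel (fun _ => P).
Proof. apply borel_open. intros x Hx. exists 1. split; [lra|auto]. Qed.

Lemma sum_f_R0_eventually_zero (f : nat -> R) N :
  (forall n, (N < n)%nat -> f n = 0) -> infinite_sum f (sum_f_R0 f N).
Proof.
  intros H eps Heps. exists N. intros n Hn.
  replace (sum_f_R0 f n) with (sum_f_R0 f N).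
  - unfold Rdist. rewrite Rminus_diag, Rabs_R0. lra.
  - induction Hn as [|n Hn IH]; [auto|]. simpl. rewrite H by lia. lra.
Qed.

Section Measure.
Variable m : (c0Z -> Prop) -> R.
Hypothesis Hm : borel_probability m.

Let m_nonneg : forall A, borel A -> 0 <= m A := proj1 Hm.

Lemma measure_sum_le A N : (forall n, borel (A n)) ->
  (forall i j x, i <> j -> A i x -> A j x -> False) ->
  sum_f_R0 (fun n => m (A n)) N <= m (fun x => exists n, A n x).
Proof.
  intros HA Hd. apply sum_incr; [|auto]. apply Hm; auto.
Qed.

(** Two terms of the constant sequence of empty sets already bound twice this measure by the measure
    itself. *)
Lemma measure_empty : m (fun _ => False) = 0.
Proof.
  pose proof (measure_sum_le (fun _ _ => False) 1 (fun _ => borel_const False)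
    ltac:(auto)) as H.
  pose proof (m_nonneg _ (borel_const False)). simpl in H.
  replace (fun x : c0Z => exists _ : nat, False) with (fun _ : c0Z => False) in H; [lra|].
  apply pred_ext. intros x. split; [tauto|]. now intros [].
Qed.

Lemma measure_disjoint A B : borel A -> borel B -> (forall x, A x -> B x -> False) ->
  m (fun x => A x \/ B x) = m A + m B.
Proof.
  intros HA HB Hd.
  set (C := fun (n : nat) => match n with O => A | 1%nat => B | _ => fun _ => False end).
  assert (HC : forall n, borel (C n)) by (intros [|[|n]]; simpl; auto using borel_const).
  assert (Hs : infinite_sum (fun n => m (C n)) (m (fun x => exists n, C n x))).
  { apply Hm; auto. intros [|[|i]] [|[|j]] x Hij; simpl; try tauto; eauto. }
  assert (Hs' : infinite_sum (fun n => m (C n)) (m A + m B)).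
  { apply (sum_f_R0_eventually_zero (fun n => m (C n)) 1).
    intros [|[|n]] Hn; [lia|lia|]. apply measure_empty. }
  rewrite <- (uniqueness_sum _ _ _ Hs Hs'). f_equal. apply pred_ext. intros x. split.
  - intros [H|H]; [now exists 0%nat|now exists 1%nat].
  - intros [[|[|n]] H]; simpl in H; tauto.
Qed.

Lemma measure_diff A B : borel A -> borel B -> (forall x, B x -> A x) ->
  m A = m B + m (fun x => A x /\ ~ B x).
Proof.
  intros HA HB H. rewrite <- measure_disjoint; auto using borel_and, borel_compl.
  - f_equal. apply pred_ext. intros x. pose proof (H x). destruct (classic (B x)); tauto.
  - tauto.
Qed.

Lemma measure_mono A B : borel A -> borel B -> (forall x, B x -> A x) -> m B <= m A.
Proof.
  intros HA HB H. rewrite (measure_diff A B HA HB H).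
  pose proof (m_nonneg _ (borel_and _ _ HA (borel_compl _ HB))). simpl in *. lra.
Qed.

(** Continuity from above as a telescoping series: the successive differences partition the part of
    [A O] outside the intersection. *)
Lemma measure_decreasing (A : nat -> c0Z -> Prop) :
  (forall n, borel (A n)) -> (forall n x, A (S n) x -> A n x) ->
  infinite_sum (fun n => m (A n) - m (A (S n)))
    (m (A O) - m (fun x => forall n, A n x)).
Proof.
  intros HA Hdec.
  assert (Hle : forall i j, (i <= j)%nat -> forall x, A j x -> A i x).
  { intros i j Hij; induction Hij; auto. }
  set (D := fun n x => A n x /\ ~ A (S n) x).
  assert (HD : forall n, borel (D n)) by (intros n; apply borel_and; auto using borel_compl).
  assert (Hs : infinite_sum (fun n => m (D n)) (m (fun x => exists n, D n x))).
  { apply Hm; auto. intros i j x Hij [H1 H2] [H3 H4].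
    destruct (Nat.lt_total i j) as [H|[H|H]]; [|auto|].
    - apply H2, (Hle (S i) j); auto.
    - apply H4, (Hle (S j) i); auto. }
  replace (fun n => m (A n) - m (A (S n))) with (fun n => m (D n)).
  2:{ apply functional_extensionality. intros n.
      rewrite (measure_diff (A n) (A (S n))); auto. unfold D. lra. }
  replace (m (A O) - m (fun x => forall n, A n x)) with (m (fun x => exists n, D n x)); auto.
  rewrite (measure_diff (A O) (fun x => forall n, A n x)); auto using borel_all.
  replace (fun x => exists n, D n x) with (fun x => A O x /\ ~ forall n, A n x); [lra|].
  apply pred_ext. intros x. split.
  - intros [H0 Hn]. apply NNPP. intros Hc. apply Hn. intros n.
    induction n as [|n IH]; auto. apply NNPP. intros Hc'. apply Hc. now exists n.
  - intros [n [H1 H2]]. split; [apply (Hle O n); auto; lia|auto].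
Qed.

Lemma measure_decreasing_empty (A : nat -> c0Z -> Prop) c :
  (forall n, borel (A n)) -> (forall n x, A (S n) x -> A n x) ->
  (forall x, exists n, ~ A n x) -> (forall n, c <= m (A n)) -> c <= 0.
Proof.
  intros HA Hdec Hempty Hc. pose proof (measure_decreasing A HA Hdec) as H.
  replace (fun x => forall n, A n x) with (fun _ : c0Z => False) in H.
  2:{ apply pred_ext. intros x. split; [tauto|]. intros Hx. destruct (Hempty x). auto. }
  rewrite measure_empty in H. destruct (Rle_or_lt c 0) as [|Hpos]; auto.
  destruct (H c Hpos) as [N HN]. specialize (HN N ltac:(auto)).
  assert (E : sum_f_R0 (fun n => m (A n) - m (A (S n))) N = m (A O) - m (A (S N))).
  { clear. induction N as [|N IH]; simpl; [lra|]. simpl in IH. lra. }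
  rewrite E in HN. unfold Rdist in HN. specialize (Hc (S N)).
  apply Rabs_def2 in HN. lra.
Qed.

End Measure.

(** * Iterates, bounded vectors and preimages of Borel sets *)

Lemma iter_succ {X : Type} (T : X -> X) n x : iter n T (T x) = iter (S n) T x.
Proof. induction n as [|n IH]; simpl in *; congruence. Qed.

Lemma iter_add {X : Type} (T : X -> X) n k x : iter n T (iter k T x) = iter (n + k) T x.
Proof. induction n as [|n IH]; simpl; congruence. Qed.

Lemma cval_bounded (x : c0Z) : exists M : nat, forall n, Rabs (cval x n) <= INR M.
Proof.
  destruct (proj2_sig x 1 ltac:(lra)) as [N HN]. fold (cval x) in HN.
  assert (H : forall k : nat, exists M : nat, forall n, (Z.abs n <= Z.of_nat k)%Z -> Rabs (cval x n) <= INR M).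
  { induction k as [|k [M HM]].
    - destruct (INR_unbounded (Rabs (cval x 0%Z))) as [M HM]. exists M.
      intros n Hn. replace n with 0%Z by lia. lra.
    - destruct (INR_unbounded (Rabs (cval x (Z.of_nat (S k))))) as [M1 HM1].
      destruct (INR_unbounded (Rabs (cval x (- Z.of_nat (S k)))%Z)) as [M2 HM2].
      exists (M + M1 + M2)%nat. intros n Hn. rewrite !plus_INR.
      pose proof (pos_INR M). pose proof (pos_INR M1). pose proof (pos_INR M2).
      destruct (Z.eq_dec n (Z.of_nat (S k))) as [->|Hn1]; [lra|].
      destruct (Z.eq_dec n (- Z.of_nat (S k))) as [->|Hn2]; [lra|].
      specialize (HM n ltac:(lia)). lra. }
  destruct (H (Z.to_nat N)) as [M HM]. exists (S M). intros n.
  rewrite S_INR. pose proof (pos_INR M).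
  destruct (Z.le_gt_cases (Z.abs n) (Z.of_nat (Z.to_nat N))) as [Hn|Hn].
  - specialize (HM n Hn). lra.
  - specialize (HN n ltac:(lia)). lra.
Qed.

Definition coord0_gt (r : R) (x : c0Z) : Prop := r < Rabs (cval x 0%Z).
Definition norm_gt (r : R) (x : c0Z) : Prop := exists n, r < Rabs (cval x n).

Lemma coord_gt_open r n : is_open (fun x => r < Rabs (cval x n)).
Proof.
  intros x Hx. exists (Rabs (cval x n) - r). split; [lra|].
  intros y [s [Hs Hy]]. specialize (Hy n).
  pose proof (Rabs_triang_inv (cval x n) (cval y n)). lra.
Qed.

Lemma norm_gt_open r : is_open (norm_gt r).
Proof.
  intros x [n Hx]. destruct (coord_gt_open r n x Hx) as [e [He H]].
  exists e. split; [auto|]. intros y Hy. exists n. auto.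
Qed.

Lemma bounded_linear_preimage_open T U :
  bounded_linear_operator T -> is_open U -> is_open (fun x => U (T x)).
Proof.
  intros [HT [C [HC Hb]]] HU x Hx. destruct (HU _ Hx) as [e [He H]].
  (* The bound [C] may be [0], hence [C + 1]. *)
  exists (e / (C + 1)). split; [apply Rdiv_lt_0_compat; lra|].
  intros y [s [Hs Hy]]. apply H. exists (C * s).
  assert (Hs0 : 0 <= s) by (eapply Rle_trans; [apply Rabs_pos|apply (Hy 0%Z)]).
  split.
  - apply (Rmult_lt_compat_r (C + 1)) in Hs; [|lra].
    unfold Rdiv in Hs. rewrite Rmult_assoc, Rinv_l in Hs by lra. nra.
  - assert (Hv : vanishes_at_infinity (fun n => 1 * cval x n + (-1) * cval y n)).
    { intros d Hd. destruct (proj2_sig x (d / 2) ltac:(lra)) as [N1 H1].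
      destruct (proj2_sig y (d / 2) ltac:(lra)) as [N2 H2]. exists (Z.max N1 N2).
      intros n Hn. specialize (H1 n ltac:(lia)). specialize (H2 n ltac:(lia)).
      fold (cval x) in H1. fold (cval y) in H2.
      apply Rabs_def2 in H1. apply Rabs_def2 in H2. apply Rabs_def1; lra. }
    set (w := exist _ _ Hv : c0Z). intros n.
    pose proof (HT 1 (-1) x y w (fun _ => eq_refl) n) as E.
    replace (cval (T x) n - cval (T y) n) with (cval (T w) n) by lra.
    apply Hb. intros k. simpl.
    replace (1 * cval x k + -1 * cval y k) with (cval x k - cval y k) by lra. auto.
Qed.

Lemma borel_preimage T A : bounded_linear_operator T -> borel A -> borel (fun x => A (T x)).
Proof.
  intros HT HA. induction HA as [U HU|A HA IH|A HA IH].
  - apply borel_open. now apply bounded_linear_preimage_open.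
  - now apply (borel_compl (fun x => A (T x))).
  - now apply (borel_union (fun n x => A n (T x))).
Qed.

Lemma borel_preimage_iter T A n :
  bounded_linear_operator T -> borel A -> borel (fun x => A (iter n T x)).
Proof.
  intros HT HA. induction n as [|n IH]; [exact HA|].
  apply (borel_ext (fun x => A (iter n T (T x)))).
  - intros x. now rewrite iter_succ.
  - now apply (borel_preimage T (fun x => A (iter n T x))).
Qed.

Lemma invariant_iter T m A n : bounded_linear_operator T -> invariant_measure T m ->
  borel A -> m (fun x => A (iter n T x)) = m A.
Proof.
  intros HT Hi HA. induction n as [|n IH]; [reflexivity|].
  rewrite <- IH, <- (Hi _ (borel_preimage_iter T A n HT HA)).
  f_equal. apply pred_ext. intros x. now rewrite iter_succ.
Qed.

(** * Entrance times of an ergodic measure *)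

Section Ergodic.
Variables (T : c0Z -> c0Z) (m : (c0Z -> Prop) -> R) (U : c0Z -> Prop).
Hypotheses (HT : bounded_linear_operator T) (Hm : borel_probability m)
  (Hi : invariant_measure T m) (He : ergodic T m) (HU : borel U) (Hpos : 0 < m U).

Definition entrance (k : nat) (x : c0Z) : Prop :=
  U (iter k T x) /\ forall j, (j < k)%nat -> ~ U (iter j T x).

Lemma borel_entrance k : borel (entrance k).
Proof.
  apply borel_and; [now apply borel_preimage_iter|].
  apply (borel_all (fun j x => (j < k)%nat -> ~ U (iter j T x))). intros j.
  destruct (Nat.lt_ge_cases j k).
  - apply (borel_ext (fun x => ~ U (iter j T x))); [tauto|].
    apply borel_compl. now apply borel_preimage_iter.
  - apply (borel_ext (fun x => True)); [|apply borel_const]. intros x. split; [lia|auto].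
Qed.

Lemma entrance_disjoint i j x : i <> j -> entrance i x -> entrance j x -> False.
Proof.
  intros Hij [H1 H2] [H3 H4]. destruct (Nat.lt_total i j) as [H|[H|H]]; auto.
  - now apply (H4 i).
  - now apply (H2 j).
Qed.

Lemma entrance_exists x k : U (iter k T x) -> exists j, entrance j x.
Proof.
  induction k as [k IH] using lt_wf_ind. intros H.
  destruct (classic (exists j, (j < k)%nat /\ U (iter j T x))) as [[j [Hj Hu]]|Hn].
  - now apply (IH j).
  - exists k. split; auto. intros j Hj Hu. apply Hn. now exists j.
Qed.

(** The set [G] of points whose orbit meets [U] contains its preimage but need not equal it.
    Ergodicity is therefore applied to the points that meet [U] at arbitrarily late times: this set
    is strictly invariant and, by invariance of [m], as large as [G], hence of positive measure. *)
Lemma entrance_sum : infinite_sum (fun k => m (entrance k)) 1.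
Proof.
  set (G := fun x => exists k, U (iter k T x)).
  assert (HG : borel G).
  { apply (borel_union (fun k x => U (iter k T x))). intros k. now apply borel_preimage_iter. }
  set (GN := fun n x => G (iter n T x)).
  assert (HGN : forall n, borel (GN n)) by (intros n; now apply borel_preimage_iter).
  assert (Hdec : forall n x, GN (S n) x -> GN n x).
  { intros n x [k Hk]. exists (S k). rewrite <- iter_succ. exact Hk. }
  assert (HmG : forall n, m (GN n) = m G) by (intros n; now apply invariant_iter).
  assert (Hall : m (fun x => forall n, GN n x) = m G).
  { pose proof (measure_decreasing m Hm GN HGN Hdec) as H.
    assert (H0 : infinite_sum (fun n => m (GN n) - m (GN (S n)))
      (sum_f_R0 (fun n => m (GN n) - m (GN (S n))) 0)).
    { apply sum_f_R0_eventually_zero. intros n _. rewrite !HmG. lra. }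
    pose proof (uniqueness_sum _ _ _ H H0) as E. simpl in E. rewrite !HmG in E. lra. }
  assert (HUG : m U <= m G).
  { apply measure_mono; auto. intros x Hx. exists 0%nat. exact Hx. }
  assert (HG1 : m G = 1).
  { destruct (He (fun x => forall n, GN n x)) as [H|H].
    - now apply borel_all.
    - intros x. unfold GN. split.
      + intros H n. apply Hdec. unfold GN. rewrite <- iter_succ. apply H.
      + intros H n. rewrite iter_succ. apply (H (S n)).
    - lra.
    - lra. }
  rewrite <- HG1.
  replace G with (fun x => exists k, entrance k x).
  - apply Hm; [exact borel_entrance|exact entrance_disjoint].
  - apply pred_ext. intros x. split.
    + intros [k [Hk _]]. now exists k.
    + intros [k Hk]. now apply entrance_exists in Hk.
Qed.

End Ergodic.

(** * Finite sums and averaging over entrance times *)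

Fixpoint rsum (f : nat -> R) (n : nat) : R :=
  match n with O => 0 | S k => rsum f k + f k end.

Lemma rsum_sum_f_R0 f n : rsum f (S n) = sum_f_R0 f n.
Proof. induction n as [|n IH]; [simpl; lra|]. rewrite tech5, <- IH. reflexivity. Qed.

Lemma rsum_le f g n : (forall i, (i < n)%nat -> f i <= g i) -> rsum f n <= rsum g n.
Proof.
  induction n as [|n IH]; intros H; simpl; [lra|].
  apply Rplus_le_compat; auto.
Qed.

Lemma rsum_const c n : rsum (fun _ => c) n = INR n * c.
Proof. induction n as [|n IH]; [simpl; lra|]. cbn [rsum]. rewrite IH, S_INR. lra. Qed.

Lemma rsum_plus f g n : rsum (fun i => f i + g i) n = rsum f n + rsum g n.
Proof. induction n as [|n IH]; simpl; lra. Qed.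

Lemma rsum_mult_r f c n : rsum (fun i => f i * c) n = rsum f n * c.
Proof. induction n as [|n IH]; simpl; lra. Qed.

Lemma rsum_exchange (f : nat -> nat -> R) n k :
  rsum (fun i => rsum (f i) k) n = rsum (fun j => rsum (fun i => f i j) n) k.
Proof.
  induction n as [|n IH]; simpl.
  - rewrite rsum_const. lra.
  - now rewrite rsum_plus, IH.
Qed.

Lemma count_rsum P a n : INR (count P a n) = rsum (fun i => if P (a + i)%nat then 1 else 0) n.
Proof.
  induction n as [|n IH]; [reflexivity|]. cbn [count rsum]. rewrite plus_INR, IH.
  now destruct (P (a + n)%nat).
Qed.

(* Averaging over the times [n] in a window where [depth (n - k)] vanishes for half of
   the [n], whatever the entrance time [k]. *)
Lemma norm_gt_measure_ge T m r :
  bounded_linear_operator T -> borel_probability m -> invariant_measure T m ->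
  ergodic T m -> full_support m ->
  (forall x d, depth d = 0%nat -> coord0_gt r x -> norm_gt r (iter d T x)) ->
  / 4 <= m (norm_gt r).
Proof.
  intros HT Hm Hi He Hf Hd. set (U := coord0_gt r).
  assert (HUo : is_open U) by apply coord_gt_open.
  assert (Hpos : 0 < m U).
  { apply Hf; auto.
    assert (Hv : vanishes_at_infinity (fun n => if Z.eqb n 0 then Rabs r + 1 else 0)).
    { intros e Hepos. exists 0%Z. intros n Hn. destruct (Z.eqb_spec n 0); [lia|].
      rewrite Rabs_R0; lra. }
    exists (exist _ _ Hv). unfold U, coord0_gt. simpl.
    pose proof (Rle_abs r). pose proof (Rle_abs (Rabs r + 1)). lra. }
  pose proof (entrance_sum T m U HT Hm Hi He (borel_open _ HUo) Hpos) as Hsum.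
  pose proof (borel_entrance T U HT (borel_open _ HUo)) as HB.
  set (g := fun k => m (entrance T U k)) in *.
  assert (Hg : forall k, 0 <= g k) by (intros k; apply Hm, HB).
  (* More than half of the mass enters [U] at a time at most [K]. *)
  destruct (Hsum (/ 2) ltac:(lra)) as [K HK]. specialize (HK K ltac:(auto)).
  unfold Rdist in HK. apply Rabs_def2 in HK. rewrite <- rsum_sum_f_R0 in HK.
  (* As [K < w <= 16 ^ w], the start [5 * L - k] stays in the range of [count_depth_zero] for every
     [k <= K]. *)
  set (w := S K). pose proof (pow16_ge w ltac:(lia)) as Hw.
  set (c := fun n k => (depth (n - k) =? 0)%nat).
  (* A point of entrance time [k] has norm above [r] at time [n] if [depth (n - k)] vanishes. For
     different [k] these events are disjoint, and all lie in the preimage of [norm_gt r] under the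
     [n]-th iterate. *)
  assert (Hbn : forall n, (K <= n)%nat ->
    rsum (fun k => (if c n k then 1 else 0) * g k) (S K) <= m (norm_gt r)).
  { intros n Hn.
    rewrite <- (invariant_iter T m _ n HT Hi (borel_open _ (norm_gt_open r))).
    set (A := fun k x => ((k <= K)%nat /\ c n k = true) /\ entrance T U k x).
    assert (HA : forall k, borel (A k)) by (intros k; apply borel_and; auto using borel_const).
    eapply Rle_trans; [|apply (measure_mono m Hm _ (fun x => exists k, A k x))].
    - eapply Rle_trans; [|apply (measure_sum_le m Hm A K HA)].
      + rewrite <- rsum_sum_f_R0. apply rsum_le. intros k Hk.
        destruct (c n k) eqn:Ec.
        * replace (A k) with (entrance T U k); [unfold g; lra|].
          apply pred_ext. intros x. unfold A. assert (k <= K)%nat by lia. tauto.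
        * rewrite Rmult_0_l. apply Hm, HA.
      + intros i j x Hij [_ H1] [_ H2]. now apply (entrance_disjoint T U i j x).
    - apply borel_preimage_iter; auto. apply borel_open, norm_gt_open.
    - now apply borel_union.
    - intros x [k [[Hk Ec] [Hu _]]].
      replace n with ((n - k) + k)%nat by lia. rewrite <- iter_add.
      apply Hd; auto. now apply Nat.eqb_eq. }
  set (L := (16 ^ w)%nat) in *.
  assert (Htot : rsum (fun i => rsum (fun k => (if c (5 * L + i)%nat k then 1 else 0) * g k) (S K)) L
    <= INR L * m (norm_gt r)).
  { rewrite <- rsum_const. apply rsum_le. intros i _. apply Hbn. lia. }
  rewrite rsum_exchange in Htot.
  (* Each [k] finds depth zero at no less than half of the [L] times; with mass above 1/2 the total
     exceeds [L / 4]. *)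
  assert (Hlow : rsum (fun k => INR L / 2 * g k) (S K) <=
    rsum (fun j => rsum (fun i => (if c (5 * L + i)%nat j then 1 else 0) * g j) L) (S K)).
  { apply rsum_le. intros k Hk. rewrite rsum_mult_r.
    apply Rmult_le_compat_r; [auto|].
    pose proof (count_depth_zero w (5 * L - k) ltac:(lia) ltac:(fold L; lia)) as Hc.
    fold L in Hc. apply le_INR in Hc. rewrite mult_INR, count_rsum in Hc. simpl INR in Hc.
    replace (rsum (fun i => if c (5 * L + i)%nat k then 1 else 0) L) with
      (rsum (fun i => if (depth (5 * L - k + i) =? 0)%nat then 1 else 0) L); [lra|].
    f_equal. apply functional_extensionality. intros i. unfold c.
    now replace (5 * L + i - k)%nat with (5 * L - k + i)%nat by lia. }
  assert (Hl2 : rsum (fun k => INR L / 2 * g k) (S K) = rsum g (S K) * (INR L / 2)).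
  { rewrite <- rsum_mult_r. f_equal. apply functional_extensionality. intros k. lra. }
  assert (0 < INR L) by (apply lt_0_INR; lia).
  nra.
Qed.

(** * The weighted shift *)

Definition weight (j : Z) : R :=
  if (0 <=? j)%Z then (/ 2) ^ Z.to_nat j else (/ 2) ^ depth (Z.to_nat (- j)).

Lemma half_pow_pos n : 0 < (/ 2) ^ n.
Proof. apply pow_lt. lra. Qed.

Lemma half_pow_le n k : (n <= k)%nat -> (/ 2) ^ k <= (/ 2) ^ n.
Proof.
  induction 1 as [|k _ IH]; [lra|]. simpl. pose proof (half_pow_pos k). lra.
Qed.

Lemma weight_pos j : 0 < weight j.
Proof. unfold weight. destruct (0 <=? j)%Z; apply half_pow_pos. Qed.

Lemma weight_le_1 j : weight j <= 1.
Proof.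
  unfold weight. change 1 with ((/ 2) ^ 0).
  destruct (0 <=? j)%Z; apply half_pow_le; lia.
Qed.

Lemma weight_neg d : weight (- Z.of_nat d) = (/ 2) ^ depth d.
Proof.
  unfold weight. destruct (Z.leb_spec 0 (- Z.of_nat d)).
  - now replace d with 0%nat by lia.
  - do 2 f_equal. lia.
Qed.

(** On the negative side, depth drops by at most one per step; upward jumps of the depth only make
    the ratio smaller. *)
Lemma weight_succ j : weight j <= 2 * weight (j + 1).
Proof.
  destruct (Z.le_gt_cases 0 j) as [Hj|Hj].
  - unfold weight. rewrite !(proj2 (Z.leb_le _ _)) by lia.
    replace (Z.to_nat (j + 1)) with (S (Z.to_nat j)) by lia. simpl. lra.
  - replace j with (- Z.of_nat (S (Z.to_nat (- j - 1))))%Z by lia.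
    set (d := Z.to_nat (- j - 1)).
    replace (- Z.of_nat (S d) + 1)%Z with (- Z.of_nat d)%Z by lia.
    rewrite !weight_neg. pose proof (half_pow_le _ _ (depth_succ d)) as H.
    rewrite <- tech_pow_Rmult in H. lra.
Qed.

Lemma weight_ratio j : 0 < weight j / weight (j + 1) <= 2.
Proof.
  pose proof (weight_pos j). pose proof (weight_pos (j + 1)).
  split; [now apply Rdiv_lt_0_compat|]. apply (Rmult_le_reg_r (weight (j + 1))); [lra|].
  unfold Rdiv. rewrite Rmult_assoc, Rinv_l, Rmult_1_r by lra. apply weight_succ.
Qed.

Lemma shift_vanishes (x : c0Z) :
  vanishes_at_infinity (fun j => weight j / weight (j + 1) * cval x (j + 1)%Z).
Proof.
  intros e He. destruct (proj2_sig x (e / 2) ltac:(lra)) as [N HN].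
  fold (cval x) in HN. exists (N + 1)%Z. intros n Hn.
  specialize (HN (n + 1)%Z ltac:(lia)). pose proof (weight_ratio n) as [H1 H2].
  rewrite Rabs_mult, (Rabs_pos_eq (_ / _)) by lra.
  pose proof (Rabs_pos (cval x (n + 1)%Z)). nra.
Qed.

Definition shift (x : c0Z) : c0Z := exist _ _ (shift_vanishes x).

Lemma shift_bounded_linear : bounded_linear_operator shift.
Proof.
  split.
  - intros a b x y z H n. simpl. rewrite H. ring.
  - exists 2. split; [lra|]. intros x r H n. simpl.
    pose proof (weight_ratio n) as [H1 H2]. specialize (H (n + 1)%Z).
    rewrite Rabs_mult, (Rabs_pos_eq (_ / _)) by lra.
    pose proof (Rabs_pos (cval x (n + 1)%Z)). nra.
Qed.

Lemma shift_iter n x j :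
  cval (iter n shift x) j = weight j / weight (j + Z.of_nat n) * cval x (j + Z.of_nat n)%Z.
Proof.
  revert j. induction n as [|n IH]; intros j.
  - rewrite Z.add_0_r. simpl. field. apply Rgt_not_eq, weight_pos.
  - change (cval (iter (S n) shift x) j) with
      (weight j / weight (j + 1) * cval (iter n shift x) (j + 1)%Z).
    rewrite IH. replace (j + 1 + Z.of_nat n)%Z with (j + Z.of_nat (S n))%Z by lia.
    field. split; apply Rgt_not_eq, weight_pos.
Qed.

(** Coordinate [- d] of the iterate is [x_0] times [weight (- d) / weight 0], and both weights are
    1. *)
Lemma shift_depth_zero r x d :
  depth d = 0%nat -> coord0_gt r x -> norm_gt r (iter d shift x).
Proof.
  intros Hd Hx. exists (- Z.of_nat d)%Z.
  rewrite shift_iter, weight_neg, Hd, Z.add_opp_diag_l.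
  change (weight 0) with 1. simpl. rewrite Rdiv_1_r, Rmult_1_l. exact Hx.
Qed.

Lemma shift_no_ergodic_measure :
  ~ exists m, borel_probability m /\ invariant_measure shift m /\
      ergodic shift m /\ full_support m.
Proof.
  intros [m (Hm & Hi & He & Hf)].
  enough (/ 4 <= 0) by lra.
  apply (measure_decreasing_empty m Hm (fun n => norm_gt (INR n))).
  - intros n. apply borel_open, norm_gt_open.
  - intros n x [j Hj]. exists j. rewrite S_INR in Hj. lra.
  - intros x. destruct (cval_bounded x) as [M HM]. exists M.
    intros [j Hj]. specialize (HM j). lra.
  - intros n. apply (norm_gt_measure_ge shift); auto using shift_bounded_linear.
    intros x d. apply shift_depth_zero.
Qed.

(** * A frequently hypercyclic vector *)

(** One factor [(/ 2) ^ r] absorbs the bound [p] on the values of the [p]-th vector; the other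
    remains as the error. *)
Lemma INR_half_pow p r : (p <= r)%nat -> INR p * (/ 2) ^ (2 * r) <= (/ 2) ^ r.
Proof.
  intros H. replace (2 * r)%nat with (r + r)%nat by lia. rewrite pow_add.
  rewrite <- Rmult_assoc.
  enough (INR p * (/ 2) ^ r <= 1) by (pose proof (half_pow_pos r); nra).
  apply Rle_trans with (INR (2 ^ r) * (/ 2) ^ r).
  - apply Rmult_le_compat_r; [apply Rlt_le, half_pow_pos|].
    apply le_INR. pose proof (pow2_gt r). lia.
  - rewrite pow_INR. simpl INR. rewrite <- Rpow_mult_distr.
    replace ((1 + 1) * / 2) with 1 by field. rewrite pow1. lra.
Qed.

Section Superposition.
Variable z : nat -> Z -> R.
Hypothesis z_bounded : forall p i, Rabs (z p i) <= INR p.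
Hypothesis z_support : forall p i, (Z.of_nat p < Z.abs i)%Z -> z p i = 0.

Let near (j : Z) (pn : nat * nat) : Prop :=
  visit (fst pn) (snd pn) /\ (Z.abs (j - Z.of_nat (snd pn)) <= Z.of_nat (fst pn))%Z.

(* The sum over [p] and over the visits [n] of [p] of the translates of [z p] by [n];
   the supports of the summands are disjoint. *)
Definition superposition (j : Z) : R :=
  match excluded_middle_informative (exists pn, near j pn) with
  | left h =>
      let pn := proj1_sig (constructive_indefinite_description _ h) in
      z (fst pn) (j - Z.of_nat (snd pn))
  | right _ => 0
  end.

Lemma superposition_cases j :
  superposition j = 0 \/
  exists p n, visit p n /\ (Z.abs (j - Z.of_nat n) <= Z.of_nat p)%Z /\
    superposition j = z p (j - Z.of_nat n).
Proof.
  unfold superposition.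
  destruct (excluded_middle_informative _) as [h|h]; [right|now left].
  destruct (constructive_indefinite_description _ h) as [[p n] [H1 H2]].
  simpl in *. now exists p, n.
Qed.

Lemma superposition_at p n j :
  visit p n -> (Z.abs (j - Z.of_nat n) <= Z.of_nat p)%Z ->
  superposition j = z p (j - Z.of_nat n).
Proof.
  intros Hv Hj. unfold superposition.
  destruct (excluded_middle_informative _) as [h|h].
  2:{ elim h. now exists (p, n). }
  destruct (constructive_indefinite_description _ h) as [[q k] [H1 H2]].
  simpl in *.
  (* The difference is an anchor of some order [r] above both indices, hence at least [8 * r], so
     the two supports cannot meet. *)
  assert (Hsep : forall p q n k, visit p n -> visit q k -> (n < k)%nat -> (p + q < k - n)%nat).
  { intros p' q' n' k' Hp Hq Hlt.
    destruct (visit_sep _ _ _ _ Hp Hq Hlt) as [r (Hr1 & Hr2 & Ha)].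
    pose proof (anchor_large _ _ Ha). pose proof (pow16_ge r ltac:(lia)). lia. }
  destruct (Nat.lt_total n k) as [H|[H|H]].
  - specialize (Hsep p q n k Hv H1 H). lia.
  - subst k. now rewrite (visit_unique p q n).
  - specialize (Hsep q p k n H1 Hv H). lia.
Qed.

Lemma superposition_vanishes : vanishes_at_infinity (fun j => weight j * superposition j).
Proof.
  intros e He.
  destruct (pow_lt_1_zero (/ 2) ltac:(rewrite Rabs_pos_eq; lra) e He) as [N HN].
  exists (4 * Z.of_nat N)%Z. intros j Hj.
  destruct (superposition_cases j) as [->|(p & n & Hv & Hjn & ->)].
  { now rewrite Rmult_0_r, Rabs_R0. }
  pose proof (visit_large p n Hv).
  set (k := Z.to_nat j).
  (* A copy around [n] lives at [j >= n - p > 15 * p], so half of the decay [(/ 2) ^ j] beats its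
     size [p]. *)
  assert (Hr : (p <= k / 2)%nat) by (apply Nat.div_le_lower_bound; lia).
  assert (HNr : (N <= k / 2)%nat) by (apply Nat.div_le_lower_bound; lia).
  rewrite Rabs_mult, (Rabs_pos_eq (weight j)) by apply Rlt_le, weight_pos.
  specialize (HN (k / 2)%nat HNr).
  rewrite Rabs_pos_eq in HN by apply Rlt_le, half_pow_pos.
  eapply Rle_lt_trans; [|exact HN]. eapply Rle_trans; [|exact (INR_half_pow p _ Hr)].
  rewrite Rmult_comm. apply Rmult_le_compat; auto using Rabs_pos.
  - apply Rlt_le, weight_pos.
  - unfold weight. rewrite (proj2 (Z.leb_le 0 j)) by lia.
    apply half_pow_le. apply Nat.Div0.mul_div_le.
Qed.

Definition superposition_vector : c0Z := exist _ _ superposition_vanishes.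

(** At a visit time of [q] its copy of [z q] is centred at the origin. Any other copy is centred at
    a nonzero difference of visit times, and on its support the weight is at most [(/ 2) ^ (2 * r)]
    with [r] at least both indices: through [depth] on the left, through the geometric decay on the
    right. *)
Lemma superposition_iter q m j : visit q m ->
  Rabs (cval (iter m shift superposition_vector) j - weight j * z q j) <= (/ 2) ^ q.
Proof.
  intros Hm. rewrite shift_iter. simpl.
  replace (weight j / weight (j + Z.of_nat m) *
    (weight (j + Z.of_nat m) * superposition (j + Z.of_nat m)))
    with (weight j * superposition (j + Z.of_nat m)) by (field; apply Rgt_not_eq, weight_pos).
  destruct (Z.le_gt_cases (Z.abs j) (Z.of_nat q)) as [Hj|Hj].
  { rewrite (superposition_at q m) by (auto; lia).
    replace (j + Z.of_nat m - Z.of_nat m)%Z with j by lia.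
    rewrite Rminus_diag, Rabs_R0. apply Rlt_le, half_pow_pos. }
  rewrite (z_support q j) by lia. rewrite Rmult_0_r, Rminus_0_r.
  destruct (superposition_cases (j + Z.of_nat m)) as [->|(p & n & Hn & Hjn & ->)].
  { rewrite Rmult_0_r, Rabs_R0. apply Rlt_le, half_pow_pos. }
  rewrite Rabs_mult, (Rabs_pos_eq (weight j)) by apply Rlt_le, weight_pos.
  assert (Hr : exists r, (p <= r)%nat /\ (q <= r)%nat /\ weight j <= (/ 2) ^ (2 * r)).
  { destruct (Nat.lt_total n m) as [H|[H|H]].
    - destruct (visit_sep p q n m Hn Hm H) as [r (Hr1 & Hr2 & Ha)].
      pose proof (anchor_large _ _ Ha). pose proof (pow16_ge r ltac:(lia)).
      exists r. repeat split; [lia|lia|].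
      replace j with (- Z.of_nat (Z.to_nat (- j)))%Z by lia.
      rewrite weight_neg. apply half_pow_le.
      apply (anchor_depth r (m - n)); auto; lia.
    - subst n. rewrite (visit_unique p q m Hn Hm) in Hjn. lia.
    - destruct (visit_sep q p m n Hm Hn H) as [r (Hr1 & Hr2 & Ha)].
      pose proof (anchor_large _ _ Ha). pose proof (pow16_ge r ltac:(lia)).
      exists r. repeat split; [lia|lia|].
      unfold weight. rewrite (proj2 (Z.leb_le 0 j)) by lia. apply half_pow_le. lia. }
  destruct Hr as [r (Hp & Hq & Hw)].
  eapply Rle_trans; [|apply half_pow_le, Hq].
  eapply Rle_trans; [|exact (INR_half_pow p r Hp)].
  rewrite Rmult_comm. apply Rmult_le_compat; auto using Rabs_pos.
  apply Rlt_le, weight_pos.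
Qed.

End Superposition.

(** * A countable dense family of finitely supported patterns *)

Fixpoint digit (l j : nat) : nat :=
  match j with
  | O => fst (of_nat l)
  | S i => digit (snd (of_nat l)) i
  end.

Lemma digit_surj n (g : nat -> nat) : exists l, forall j, (j < n)%nat -> digit l j = g j.
Proof.
  revert g. induction n as [|n IH]; intros g; [exists 0%nat; lia|].
  destruct (IH (fun j => g (S j))) as [l Hl]. exists (to_nat (g O, l)).
  intros [|j] Hj; cbn [digit]; rewrite cancel_of_to; [reflexivity|]. apply Hl. lia.
Qed.

Definition rational (c : nat) : R :=
  let (a, b) := of_nat c in
  (INR (fst (of_nat a)) - INR (snd (of_nat a))) / INR (S b).

Lemma rational_dense r e : 0 < e -> exists c, Rabs (r - rational c) < e.
Proof.
  intros He. destruct (INR_unbounded (/ e)) as [b Hb].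
  pose proof (archimed (r * INR (S b))) as [H1 H2]. set (k := up (r * INR (S b))) in *.
  exists (to_nat (to_nat (Z.to_nat k, Z.to_nat (- k)), b)).
  unfold rational. rewrite !cancel_of_to. cbn [fst snd].
  replace (INR (Z.to_nat k) - INR (Z.to_nat (- k))) with (IZR k)
    by (rewrite !INR_IZR_INZ, <- minus_IZR; f_equal; lia).
  rewrite S_INR in *. pose proof (Rinv_0_lt_compat _ He).
  assert (Heb : 1 < e * (INR b + 1)).
  { assert (e * / e = 1) by (apply Rinv_r; lra). nra. }
  replace (r - IZR k / (INR b + 1)) with ((r * (INR b + 1) - IZR k) * / (INR b + 1))
    by (field; lra).
  assert (0 < / (INR b + 1)) by (apply Rinv_0_lt_compat; lra).
  rewrite Rabs_mult, (Rabs_pos_eq (/ _)) by lra.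
  apply (Rmult_lt_reg_r (INR b + 1)); [lra|].
  rewrite Rmult_assoc, Rinv_l, Rmult_1_r by lra.
  apply Rabs_def1; lra.
Qed.

(* [p] codes a support radius [L], the values on [-L, L], and an arbitrary padding that
   makes [p] as large as desired. *)
Definition pattern (p : nat) (i : Z) : R :=
  let c := fst (of_nat p) in
  let L := fst (of_nat c) in
  let v := rational (digit (snd (of_nat c)) (Z.to_nat (i + Z.of_nat L))) in
  if excluded_middle_informative
       ((Z.abs i <= Z.of_nat L)%Z /\ (L <= p)%nat /\ Rabs v <= INR p)
  then v else 0.

Lemma pattern_bounded p i : Rabs (pattern p i) <= INR p.
Proof.
  unfold pattern. destruct (excluded_middle_informative _); [tauto|].
  rewrite Rabs_R0. apply pos_INR.
Qed.

Lemma pattern_support p i : (Z.of_nat p < Z.abs i)%Z -> pattern p i = 0.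
Proof.
  intros H. unfold pattern. destruct (excluded_middle_informative _); [lia|reflexivity].
Qed.

Lemma finite_bound (f : nat -> R) n : exists M, forall j, (j < n)%nat -> Rabs (f j) <= INR M.
Proof.
  induction n as [|n [M HM]]; [exists 0%nat; lia|].
  destruct (INR_unbounded (Rabs (f n))) as [M' HM']. exists (M + M')%nat.
  intros j Hj. rewrite plus_INR. pose proof (pos_INR M). pose proof (pos_INR M').
  destruct (Nat.eq_dec j n) as [->|Hn]; [lra|]. specialize (HM j ltac:(lia)). lra.
Qed.

Lemma pattern_dense (v : c0Z) e : 0 < e ->
  exists p, (/ 2) ^ p < e /\ forall j, Rabs (cval v j - weight j * pattern p j) <= e.
Proof.
  intros He. destruct (proj2_sig v e He) as [N HN]. fold (cval v) in HN.
  set (L := Z.to_nat N).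
  (* The weight is divided out before rational approximation; multiplying back does not enlarge the
     error, as weights are at most 1. *)
  set (f := fun j : nat => cval v (Z.of_nat j - Z.of_nat L) / weight (Z.of_nat j - Z.of_nat L)).
  set (g := fun j => proj1_sig (constructive_indefinite_description _ (rational_dense (f j) e He))).
  assert (Hg : forall j, Rabs (f j - rational (g j)) < e).
  { intros j. unfold g. destruct (constructive_indefinite_description _ _). auto. }
  clearbody g.
  destruct (digit_surj (2 * L + 1) g) as [l Hl].
  destruct (finite_bound (fun j => rational (g j)) (2 * L + 1)) as [M HM].
  destruct (pow_lt_1_zero (/ 2) ltac:(rewrite Rabs_pos_eq; lra) e He) as [K HK].
  (* The padding makes [p] at least the radius [L], the bound [M] on the values, and the rank [K]
     from which [(/ 2) ^ p < e]. *)
  set (t := (L + M + K)%nat). set (p := to_nat (to_nat (L, l), t)).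
  assert (Hp : (t <= p)%nat) by (pose proof (to_nat_non_decreasing (to_nat (L, l)) t); unfold p; lia).
  exists p. split.
  { specialize (HK p ltac:(lia)). rewrite Rabs_pos_eq in HK; [auto|apply Rlt_le, half_pow_pos]. }
  intros j. unfold pattern.
  replace (of_nat p) with (to_nat (L, l), t) by (unfold p; now rewrite cancel_of_to).
  cbn [fst]. rewrite cancel_of_to. cbn [fst snd].
  destruct (Z.le_gt_cases (Z.abs j) (Z.of_nat L)) as [Hj|Hj].
  - set (k := Z.to_nat (j + Z.of_nat L)). rewrite Hl by lia.
    specialize (HM k ltac:(lia)). specialize (Hg k).
    assert (INR M <= INR p) by (apply le_INR; lia).
    destruct (excluded_middle_informative _) as [_|Hn].
    2:{ elim Hn. repeat split; [auto|lia|lra]. }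
    unfold f in Hg. replace (Z.of_nat k - Z.of_nat L)%Z with j in Hg by lia.
    pose proof (weight_pos j). pose proof (weight_le_1 j).
    replace (cval v j - weight j * rational (g k))
      with (weight j * (cval v j / weight j - rational (g k))) by (field; lra).
    rewrite Rabs_mult, (Rabs_pos_eq (weight j)) by lra.
    pose proof (Rabs_pos (cval v j / weight j - rational (g k))). nra.
  - destruct (excluded_middle_informative _) as [Hn|_]; [lia|].
    rewrite Rmult_0_r, Rminus_0_r. apply Rlt_le, HN. lia.
Qed.

Lemma shift_frequently_hypercyclic : frequently_hypercyclic shift.
Proof.
  exists (superposition_vector pattern pattern_bounded).
  intros V HV [v Hv]. destruct (HV v Hv) as [e [He HVe]].
  destruct (pattern_dense v (e / 3) ltac:(lra)) as [p [Hp1 Hp2]].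
  apply (positive_lower_density_mono (visit p)); [|apply visit_density].
  (* One [e / 3] is the pattern approximation, the other the error [(/ 2) ^ p] of the iterate; the
     last third gives the strict bound in [dist_lt]. *)
  intros n Hn. apply HVe. exists (2 * (e / 3)). split; [lra|]. intros j.
  pose proof (superposition_iter pattern pattern_bounded pattern_support p n j Hn) as H.
  specialize (Hp2 j).
  set (y := cval (iter n shift _) j) in *.
  replace (cval v j - y) with
    ((cval v j - weight j * pattern p j) - (y - weight j * pattern p j)) by ring.
  eapply Rle_trans; [apply Rabs_triang|]. rewrite Rabs_Ropp. lra.
Qed.

Theorem theorem1p3 :
  exists T : c0Z -> c0Z,
    bounded_linear_operator T /\ frequently_hypercyclic T /\
    ~ (exists m : (c0Z -> Prop) -> R,
         borel_probability m /\ invariant_measure T m /\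
         ergodic T m /\ full_support m).
Proof.
  exists shift. split; [exact shift_bounded_linear|].
  split; [exact shift_frequently_hypercyclic|exact shift_no_ergodic_measure].
Qed.
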